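(* Let $\Omega$ be a nonempty set, $\mathcal{A}$ a quasi-semi-ring of subsets of $\Omega$, and $\mu:\mathcal{A}\to[0,\infty]$ a countably additive premeasure on $\mathcal{A}$. Let $\mu^*$ be the outer measure induced by $\mu$ and let $\mathcal{M}$ be the class of all $\mu^*$-measurable subsets of $\Omega$. Then: 1. $\mathcal{A} \subset \mathcal{M}$; 2. $\mu^*(A) = \mu(A)$ for all $A \in \mathcal{A}$.
   Context: A class $\mathcal{A}$ of subsets of a nonempty set $\Omega$ is a quasi-semi-ring if (1) $\varnothing \in \mathcal{A}$, and (2) for all $A, B \in \mathcal{A}$ there exist finitely many pairwise disjoint sets $B_1, \ldots, B_n, C_1, \ldots, C_k \in \mathcal{A}$ (with $n,k<\infty$) such that $A \cap B = \bigcup_{i=1}^n B_i$ and $A \cap B^c = \bigcup_{i=1}^k C_i$. (Closure under intersections is not required.) A (countably additive) premeasure on $\mathcal{A}$ is a function $\mu:\mathcal{A}\to[0,\infty]$ with $\mu(\varnothing)=0$ that is countably additive: whenever $\{A_j\}_{j\ge1}\subset\mathcal{A}$ are pairwise disjoint and $\bigcup_{j\ge1}A_j\in\mathcal{A}$, then $\mu(\bigcup_{j\ge1}A_j)=\sum_{j\ge1}\mu(A_j)$. The outer measure induced by $\mu$ is the function $\mu^*$ from the power set of $\Omega$ to $[0,\infty]$ given by $\mu^*(A) = \inf\{ \sum_{j\geq 1} \mu(A_j) : A \subset \bigcup_{j\geq 1} A_j,\ \{A_j\}_{j\geq 1} \subset \mathcal{A}\}$, where the covers are countable and $\inf\varnothing=\infty$.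 A set $A\subset\Omega$ is $\mu^*$-measurable if $\mu^*(E) = \mu^*(E \cap A) + \mu^*(E \cap A^c)$ for all $E \subset \Omega$. *)

(* Defs.v *)
From mathcomp Require Import all_boot all_order all_algebra.
From mathcomp Require Import boolp classical_sets reals ereal sequences measure.

Set Implicit Arguments.
Unset Strict Implicit.
Unset Printing Implicit Defensive.

Import Order.TTheory GRing.Theory Num.Theory.
Local Open Scope classical_set_scope.
Local Open Scope ring_scope.
Local Open Scope ereal_scope.

(* The [B_ i] lie in [B] and the [C_ j] in its complement, so the two families
   are disjoint from each other automatically. [trivIset] allows repeated
   occurrences of the empty set, as in the usual reading of "pairwise disjoint"
   for an indexed family. *)
Definition quasi_semi_ring (Omega : Type) (A : set (set Omega)) : Prop :=
  A set0 /\
  forall X Y : set Omega, A X -> A Y ->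
    exists (n k : nat) (B_ : 'I_n -> set Omega) (C_ : 'I_k -> set Omega),
      [/\ forall i, A (B_ i), forall j, A (C_ j),
          trivIset [set: 'I_n] B_, trivIset [set: 'I_k] C_ &
          X `&` Y = \bigcup_(i in [set: 'I_n]) B_ i /\
          X `&` ~` Y = \bigcup_(j in [set: 'I_k]) C_ j].

(* A function A -> [0, +oo] is encoded as a total function on [set Omega] whose
   values outside [A] are unconstrained. *)
Definition premeasure (R : realType) (Omega : Type) (A : set (set Omega))
    (mu : set Omega -> \bar R) : Prop :=
  [/\ forall X, A X -> 0 <= mu X,
      mu set0 = 0 &
      forall F : nat -> set Omega, (forall j, A (F j)) ->
        trivIset [set: nat] F -> A (\bigcup_j F j) ->
        mu (\bigcup_j F j) = \sum_(j <oo) mu (F j)].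

(* Analogue of the library's [mu_ext], which is tied to a [semiRingOfSetsType]
   and hence to closure under intersection. Only values of [mu] on [A] are
   used; [ereal_inf set0 = +oo]. *)
Definition induced_outer_measure (R : realType) (Omega : Type)
    (A : set (set Omega)) (mu : set Omega -> \bar R) (X : set Omega) : \bar R :=
  ereal_inf [set \sum_(j <oo) mu (F j) | F in
    [set F : nat -> set Omega | (forall j, A (F j)) /\ X `<=` \bigcup_j F j]].

(* Main.v *)
(* Intersections of members of [A] need not lie in [A], but they are finite
   disjoint unions of members of [A], and finite disjoint unions are closed
   under difference. If [X] is covered by [F 0, F 1, ...], disjointify the cover
   inside [X]: each piece [D j] of [X] contained in [F j] is a finite disjoint
   union of members of [A], whose total mass is at most [mu (F j)] because
   [F j] minus [D j] is again such a union. Countable additivity on [X] then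
   gives [mu X <= \sum_j mu (F j)]. For measurability of [Y] in [A], split
   every member of a cover of [E] along [Y]; this conserves the total mass and
   yields covers of both parts of [E]. *)
Require Import Defs.
From mathcomp Require Import all_boot all_order all_algebra.
From mathcomp Require Import boolp classical_sets functions cardinality.
From mathcomp Require Import reals ereal esum sequences measure.

Import Order.TTheory.

Local Open Scope classical_set_scope.
Local Open Scope ring_scope.

(** * Series and infima of extended reals *)

Section series.
Set Implicit Arguments.
Unset Strict Implicit.
Local Open Scope ereal_scope.

Lemma nneseries_cons (R : realType) (f : nat -> \bar R) :
  (forall j, 0 <= f j) ->
  \sum_(j <oo) f j = f 0%N + \sum_(j <oo) f j.+1.
Proof.
move=> f0; rewrite nneseries_recl//; congr (_ + _).
rewrite -nneseries_addn//; apply: eq_eseriesr => j _.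
by rewrite addn1.
Qed.

(** The bijection is chosen before [f], so that one and the same [e] can flatten a double family of
    sets and the series of its masses. *)
Lemma nneseries_pair (R : realType) : exists e : nat -> nat * nat, bijective e /\
  forall f : nat -> nat -> \bar R, (forall i j, 0 <= f i j) ->
    \sum_(n <oo) f (e n).1 (e n).2 = \sum_(i <oo) \sum_(j <oo) f i j.
Proof.
have /card_esym/ppcard_eqP[e] := card_nat2.
exists e; split; first exact: bijTT.
move=> f f0; rewrite nneseries_esumT//.
rewrite -(@reindex_esum _ _ _ setT setT e (fun k => f k.1 k.2))//.
rewrite nneseries_esumT; last by move=> i; exact: nneseries_ge0.
under [RHS]eq_esum do rewrite nneseries_esumT//.
rewrite esum_esum//; congr esum.
by apply/seteqP; split.
Qed.

(** For finite [y], subtract it from both sides; for [y = +oo], the sign of the infimum rules out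
    [-oo + +oo]. *)
Lemma le_ereal_infD (R : realType) (S : set (\bar R)) (x y : \bar R) :
  0 <= ereal_inf S -> 0 <= y -> (forall a, S a -> x <= a + y) ->
  x <= ereal_inf S + y.
Proof.
move=> S0 y0 xS; have [->|yoo] := eqVneq y +oo.
  by rewrite addey ?leey// gt_eqF// (lt_le_trans _ S0).
have yfin : y \is a fin_num by rewrite ge0_fin_numE// lt_neqAle yoo leey.
by rewrite -leeBlDr//; apply: le_ereal_inf_tmp => a Sa; rewrite leeBlDr// xS.
Qed.

End series.

(** * Decompositions into members of [A] *)

Section decomposition.
Set Implicit Arguments.
Unset Strict Implicit.
Local Open Scope ereal_scope.
Variables (R : realType) (T : Type) (A : set (set T)) (mu : set T -> \bar R).
Hypotheses (qA : quasi_semi_ring A) (pmu : premeasure A mu).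

(* [finite_decomposition X m]: [X] is a finite disjoint union of members of [A]
   whose [mu]-values add up to [m]. *)
Inductive finite_decomposition : set T -> \bar R -> Prop :=
| finite_decomposition0 : finite_decomposition set0 0
| finite_decompositionU X Y m : A X -> finite_decomposition Y m ->
    X `&` Y = set0 -> finite_decomposition (X `|` Y) (mu X + m).

Definition countable_decomposition (X : set T) (m : \bar R) := exists F,
  [/\ forall j, A (F j), trivIset [set: nat] F,
      \bigcup_j F j = X & \sum_(j <oo) mu (F j) = m].

Lemma premeasure_ge0 X : A X -> 0 <= mu X.
Proof. by case: pmu => + _ _; exact. Qed.

Lemma finite_decomposition_ge0 X m : finite_decomposition X m -> 0 <= m.
Proof.
by elim=> // {}X Y {}m AX _ m0 _; rewrite adde_ge0//; exact: premeasure_ge0.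
Qed.

Lemma finite_decomposition_disjointU X Y m n : X `&` Y = set0 ->
  finite_decomposition X m -> finite_decomposition Y n ->
  finite_decomposition (X `|` Y) (m + n).
Proof.
move=> + dX dY; elim: dX => [_|{}X Z {}m AX dZ IH XZ]; first by rewrite set0U add0e.
rewrite setIUl setU_eq0 => -[XY ZY].
rewrite -setUA -addeA; apply: finite_decompositionU => //; first exact: IH.
by rewrite setIUr XZ XY setU0.
Qed.

Lemma finite_decomposition1 X : A X -> finite_decomposition X (mu X).
Proof.
move=> AX; rewrite -[X]setU0 -[mu _]adde0 {2}setU0.
by apply: finite_decompositionU; rewrite ?setI0//; exact: finite_decomposition0.
Qed.

Lemma countable_decomposition_finite X m :
  finite_decomposition X m -> countable_decomposition X m.
Proof.
have [mu0 muE _] := pmu; have [A0 _] := qA.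
elim=> [|{}X Y {}m AX _ [F [AF tF FY Fm]] XY].
  (* Finite families are padded with [set0], a member of [A] of mass 0. *)
  exists (fun=> set0); split => //.
  - by apply/trivIsetP => i j _ _ _; rewrite setI0.
  - exact: bigcup0.
  - exact: eseries0.
exists (fun j => if j is k.+1 then F k else X); split.
- by case.
- have XF j : X `&` F j = set0.
    by rewrite -subset0 => x [Xx Fx]; rewrite -XY -FY; split => //; exists j.
  apply/trivIsetP => -[|i] [|j] _ _ //= ij; last by apply: (trivIsetP.1 tF).
  by rewrite setIC.
- apply/seteqP; split => [x [[|j] _ /= Fx]|x []].
  + by left.
  + by right; rewrite -FY; exists j.
  + by exists 0%N.
  + by rewrite -FY => -[j _ Fx]; exists j.+1.
- by rewrite nneseries_cons ?Fm//; case=> [|j]; exact: mu0.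
Qed.

Lemma countable_decomposition_mu X m :
  countable_decomposition X m -> A X -> mu X = m.
Proof.
move=> [F [AF tF <- <-]] AX.
by case: pmu => _ _; exact.
Qed.

(** Finite additivity, as countable additivity for families padded with empty sets. *)
Lemma finite_decomposition_mu X m : finite_decomposition X m -> A X -> mu X = m.
Proof.
by move=> /countable_decomposition_finite; exact: countable_decomposition_mu.
Qed.

(** Passes from the indexed families of [quasi_semi_ring] to the inductive form, splitting off index
    [ord0]. *)
Lemma finite_decomposition_ord n (B : 'I_n -> set T) :
  (forall i, A (B i)) -> trivIset [set: 'I_n] B ->
  exists m, finite_decomposition (\bigcup_i B i) m.
Proof.
elim: n B => [|n IH] B AB tB.
  exists 0; rewrite (_ : \bigcup_i _ = set0); first exact: finite_decomposition0.
  by rewrite -subset0 => x [[]].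
have [||m dB] := IH (B \o lift ord0).
- by move=> i; exact: AB.
- by apply/trivIsetP => i j _ _ ij; apply: (trivIsetP.1 tB) => //; rewrite (inj_eq lift_inj).
exists (mu (B ord0) + m).
rewrite (_ : \bigcup_i _ = B ord0 `|` \bigcup_i (B \o lift ord0) i).
  apply: finite_decompositionU => //; rewrite -subset0 => x [B0x [i _ Bix]].
  by rewrite -(trivIsetP.1 tB ord0 (lift ord0 i)).
apply/seteqP; split => [x [i _]|x [B0x|[i _ Bix]]].
- by case: (unliftP ord0 i) => [j ->|->] Bx; [right; exists j|left].
- by exists ord0.
- by exists (lift ord0 i).
Qed.

(** The pieces inside and outside [Y] together decompose [X], so finite additivity conserves the
    mass. *)
Lemma mu_split X Y : A X -> A Y -> exists p q,
  [/\ finite_decomposition (X `&` Y) p, finite_decomposition (X `\` Y) q &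
      mu X = p + q].
Proof.
move=> AX AY; have [_ /(_ X Y AX AY)] := qA.
move=> [n [k [B [C [AB AC tB tC [XYB XYC]]]]]].
have [p dB] := finite_decomposition_ord AB tB.
have [q dC] := finite_decomposition_ord AC tC.
rewrite -XYB in dB; rewrite -XYC -setDE in dC.
exists p, q; split => //.
apply: finite_decomposition_mu => //; rewrite -[X in finite_decomposition X _](setUIDK X Y).
by apply: finite_decomposition_disjointU => //; rewrite setDE setIACA setICr setI0.
Qed.

Lemma finite_decompositionD1 X m Y : finite_decomposition X m -> A Y ->
  exists q, finite_decomposition (X `\` Y) q.
Proof.
move=> + AY; elim=> [|{}X Z {}m AX _ [q dZ] XZ].
  by exists 0; rewrite set0D; exact: finite_decomposition0.
have [_ [q' [_ dX _]]] := mu_split AX AY.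
exists (q' + q); rewrite setDUD.
apply: finite_decomposition_disjointU => //.
by rewrite !setDE setIACA XZ set0I.
Qed.

(** The pieces of [Y] are removed one at a time; [X] therefore varies in the induction. *)
Lemma finite_decompositionD X m Y n :
  finite_decomposition X m -> finite_decomposition Y n ->
  exists q, finite_decomposition (X `\` Y) q.
Proof.
move=> + dY; elim: dY X m => [X m dX|{}Y Z {}n AY _ IH _ X m dX].
  by exists m; rewrite setD0.
have [q dXY] := finite_decompositionD1 dX AY.
by rewrite -setDDl; exact: IH dXY.
Qed.

Lemma finite_decompositionI X m Y : finite_decomposition X m -> A Y ->
  exists p, finite_decomposition (X `&` Y) p.
Proof.
move=> dX AY; have [q dXY] := finite_decompositionD1 dX AY.
by rewrite -setDD; exact: finite_decompositionD dX dXY.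
Qed.

(** The rest of [Y] also decomposes, and its mass is nonnegative. *)
Lemma finite_decomposition_le X m Y : finite_decomposition X m -> A Y ->
  X `<=` Y -> m <= mu Y.
Proof.
move=> dX AY XY.
have [q dYX] := finite_decompositionD (finite_decomposition1 AY) dX.
rewrite (@finite_decomposition_mu Y (m + q))//.
  by rewrite leeDl// (finite_decomposition_ge0 dYX).
rewrite -[X in finite_decomposition X _](setDUK XY).
by apply: finite_decomposition_disjointU; rewrite ?setDIK.
Qed.

Lemma countable_decomposition_bigcup (X : nat -> set T) (m : nat -> \bar R) :
  (forall i, countable_decomposition (X i) (m i)) -> trivIset [set: nat] X ->
  countable_decomposition (\bigcup_i X i) (\sum_(i <oo) m i).
Proof.
move=> /choice[F FP] tX.
have [e [ebij eE]] := nneseries_pair R.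
have [mu0 _ _] := pmu.
exists (fun n => F (e n).1 (e n).2); split.
- by move=> n; case: (FP (e n).1).
(* Pieces that meet have the same first index, as the [X i] are disjoint, and then the same second
   index, as the pieces of one [X i] are disjoint. *)
- move=> n n' _ _ [x [Fx Fx']]; apply: (bij_inj ebij).
  have FX k : F (e k).1 (e k).2 `<=` X (e k).1.
    by case: (FP (e k).1) => _ _ <- _ y Fy; exists (e k).2.
  have e1 : (e n).1 = (e n').1 by apply: tX => //; exists x; split; exact: FX.
  have e2 : (e n).2 = (e n').2.
    case: (FP (e n).1) => _ tF _ _; apply: tF => //.
    by exists x; split => //; rewrite e1.
  by rewrite (surjective_pairing (e n)) e1 e2 -surjective_pairing.
- apply/seteqP; split => [x [n _ Fx]|x [i _]].
    by exists (e n).1 => //; case: (FP (e n).1) => _ _ <- _; exists (e n).2.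
  case: (FP i) => _ _ <- _ [j _ Fx]; case: ebij => e' _ e'K.
  by exists (e' (i, j)) => //=; rewrite e'K.
- rewrite (eE (fun i j => mu (F i j))); last by move=> i j; apply: mu0; case: (FP i).
  by apply: eq_eseriesr => i _; case: (FP i).
Qed.

Lemma premeasure_le_cover X (F : nat -> set T) : A X -> (forall j, A (F j)) ->
  X `<=` \bigcup_j F j -> mu X <= \sum_(j <oo) mu (F j).
Proof.
move=> AX AF XF.
pose D j := (X `\` \big[setU/set0]_(i < j) F i) `&` F j.
(* The part of [X] not yet covered loses one [F j] per step, so it stays decomposable. *)
have dR j : exists m, finite_decomposition (X `\` \big[setU/set0]_(i < j) F i) m.
  elim: j => [|j [m dj]].
    by exists (mu X); rewrite big_ord0 setD0; exact: finite_decomposition1.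
  by rewrite big_ord_recr/= -setDDl; exact: finite_decompositionD1 dj _.
have /choice[d dD] j : exists m, finite_decomposition (D j) m.
  by have [m dj] := dR j; exact: finite_decompositionI dj _.
have tD : trivIset [set: nat] D.
  move=> i j _ _ [x [[[_ nFi] Fi] [[_ nFj] Fj]]].
  have [ij|ji|//] := ltngtP i j.
    by case: nFj; rewrite -bigcup_mkord; exists i.
  by case: nFi; rewrite -bigcup_mkord; exists j.
have DX : \bigcup_j D j = X.
  apply/seteqP; split => [x [j _ [[]]]//|x Xx].
  (* A point of [X] lies in [D j] for the least [j] with [x] in [F j]. *)
  have exF : exists j, `[< F j x >] by have [j _ Fx] := XF x Xx; exists j; exact/asboolP.
  exists (ex_minn exF) => //; case: ex_minnP => j /asboolP Fj minj; split => //; split => //.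
  rewrite -bigcup_mkord => -[i /= ij Fi].
  by have := minj i (asboolT Fi); rewrite leqNgt ij.
rewrite (@countable_decomposition_mu X (\sum_(j <oo) d j))//; last first.
  rewrite -DX; apply: countable_decomposition_bigcup => // j.
  exact/countable_decomposition_finite.
apply: lee_nneseries => [j _ _|j _]; first exact: finite_decomposition_ge0 (dD j).
by apply: finite_decomposition_le (dD j) _ _ => // x [].
Qed.

(** * The induced outer measure *)

Local Notation mu' := (induced_outer_measure A mu).

Lemma induced_outer_measure_le X (F : nat -> set T) :
  (forall j, A (F j)) -> X `<=` \bigcup_j F j -> mu' X <= \sum_(j <oo) mu (F j).
Proof. by move=> AF XF; apply: ereal_inf_lbound; exists F. Qed.

Lemma induced_outer_measure_ge0 X : 0 <= mu' X.
Proof.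
apply: le_ereal_inf_tmp => _ [F [AF _] <-].
by apply: nneseries_ge0 => j _ _; exact: premeasure_ge0.
Qed.

Lemma induced_outer_measure_le_double (F : nat -> nat -> set T) X :
  (forall i j, A (F i j)) -> X `<=` \bigcup_i \bigcup_j F i j ->
  mu' X <= \sum_(i <oo) \sum_(j <oo) mu (F i j).
Proof.
move=> AF XF; have [e [[e' _ e'K] eE]] := nneseries_pair R.
rewrite -(eE (fun i j => mu (F i j))); last by move=> i j; exact: premeasure_ge0.
apply: (@induced_outer_measure_le X (fun n => F (e n).1 (e n).2)) => // x.
by move=> /XF[i _ [j _ Fx]]; exists (e' (i, j)) => //=; rewrite e'K.
Qed.

Lemma induced_outer_measure_mu X : A X -> mu' X = mu X.
Proof.
move=> AX; apply/eqP; rewrite eq_le; apply/andP; split.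
  have [F [AF _ FX <-]] := countable_decomposition_finite (finite_decomposition1 AX).
  by apply: induced_outer_measure_le => //; rewrite FX.
by apply: le_ereal_inf_tmp => _ [F [AF XF] <-]; exact: premeasure_le_cover.
Qed.

Lemma induced_outer_measureU X Y : mu' (X `|` Y) <= mu' X + mu' Y.
Proof.
apply: le_ereal_infD; [exact: induced_outer_measure_ge0..|].
move=> _ [F [AF XF] <-]; rewrite addeC.
apply: le_ereal_infD => [||_ [G [AG YG] <-]].
- exact: induced_outer_measure_ge0.
- by apply: nneseries_ge0 => j _ _; exact: premeasure_ge0.
have [A0 _] := qA; have [_ mu0 _] := pmu.
(* The two covers become rows 0 and 1 of a double family; all later rows are empty and have mass
   0. *)
pose H i := if i is i'.+1 then if i' is _.+1 then fun=> set0 else G else F.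
have AH i j : A (H i j) by case: i => [|[|i]].
rewrite addeC (_ : _ + _ = \sum_(i <oo) \sum_(j <oo) mu (H i j)).
  apply: induced_outer_measure_le_double => // x [/XF|/YG] Hx; first by exists 0%N.
  by exists 1%N.
have H0 i : 0 <= \sum_(j <oo) mu (H i j).
  by apply: nneseries_ge0 => j _ _; exact: premeasure_ge0.
rewrite [RHS]nneseries_cons// [X in _ = _ + X]nneseries_cons//.
by rewrite [X in _ = _ + (_ + X)]eseries0 ?adde0// => i _ _; exact: eseries0.
Qed.

Lemma induced_outer_measure_measurable : A `<=` caratheodory_measurable mu'.
Proof.
move=> Y AY E; apply/eqP; rewrite eq_le; apply/andP; split.
  by rewrite -[X in mu' X](setUIDK E Y) setDE; exact: induced_outer_measureU.
apply: le_ereal_inf_tmp => _ [F [AF EF] <-].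
have /choice[p /choice[q pq]] j := mu_split (AF j) AY.
rewrite [leRHS](@eq_eseriesr _ _ (fun j => p j + q j)); last by move=> j _; case: (pq j).
rewrite nneseriesD; last 2 first.
- by move=> j _ _; case: (pq j) => /finite_decomposition_ge0.
- by move=> j _ _; case: (pq j) => _ /finite_decomposition_ge0.
(* Stated for any [Z], to serve for both [Y] and its complement: the pieces of all [F j] within [Z]
   form a cover of the part of [E] in [Z]. *)
have cover (Z : set T) (r : nat -> \bar R) :
    (forall j, finite_decomposition (F j `&` Z) (r j)) ->
    mu' (E `&` Z) <= \sum_(j <oo) r j.
  move=> dr.
  have /choice[G GP] j := countable_decomposition_finite (dr j).
  rewrite (@eq_eseriesr _ _ (fun j => \sum_(k <oo) mu (G j k))); last first.
    by move=> j _; case: (GP j).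
  apply: induced_outer_measure_le_double => [i|x [Ex Zx]]; first by case: (GP i).
  have [j _ Fx] := EF x Ex; exists j => //; case: (GP j) => _ _ -> _; by split.
apply: leeD; apply: cover => j; case: (pq j) => //.
Qed.

End decomposition.

Theorem theorem1p1 (R : realType) (Omega : Type) (Omega_neq0 : [set: Omega] !=set0)
    (A : set (set Omega)) (qA : quasi_semi_ring A)
    (mu : set Omega -> \bar R) (mu_premeasure : premeasure A mu) :
  A `<=` caratheodory_measurable (induced_outer_measure A mu) /\
  (forall X : set Omega, A X -> induced_outer_measure A mu X = mu X).
Proof.
split; first exact: induced_outer_measure_measurable.
by move=> X; exact: induced_outer_measure_mu.
Qed.
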